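(* For any commutative ring $A$, we have the canonical isomorphism of groups $\mathcal{B}(A)\simeq\mathcal{B}\big(K_0(A)\big)$.
   Context: For any commutative ring $R$, $\mathcal{B}(R)=\{e\in R: e=e^2\}$ is the abelian group of idempotents of $R$ under the operation $e\oplus e':=e+e'-2ee'$. $K_0(A)$ is the Grothendieck ring of the semiring of isomorphism classes of finitely generated projective $A$-modules (addition induced by $\oplus$, multiplication induced by $\otimes_A$). *)

(* Defs.v *)
From HB Require Import structures.
From mathcomp Require Import all_boot all_order all_algebra ring.
From mathcomp Require Import boolp.

Set Implicit Arguments.
Unset Strict Implicit.
Unset Printing Implicit Defensive.

Import GRing.Theory.
Local Open Scope ring_scope.
Local Open Scope quotient_scope.

(* [comPzRingType] is used throughout: [comNzRingType] would exclude the zero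
   ring. *)

Section Idempotents.
Variable R : comPzRingType.

Record idem := Idem { idem_val : R; idemP : idem_val == idem_val ^+ 2 }.

HB.instance Definition _ := [isSub for idem_val].
HB.instance Definition _ := [Choice of idem by <:].

Implicit Types e f : idem.

Lemma idemE e : val e * val e = val e.
Proof. by rewrite -expr2 -(eqP (idemP e)). Qed.

Fact idem_zero_subproof : 0 == 0 ^+ 2 :> R.
Proof. by rewrite expr2 mulr0. Qed.

Fact idem_add_subproof e f :
  let g := val e + val f - 2%:R * val e * val f in g == g ^+ 2.
Proof.
apply/eqP => /=; move: (idemE e) (idemE f) => /=.
set x : R := idem_val e; set y : R := idem_val f => Ex Ey.
have -> : (x + y - 2%:R * x * y) ^+ 2 =
  x * x + y * y + 4%:R * (x * x) * (y * y) + 2%:R * x * y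
   - 4%:R * (x * x) * y - 4%:R * x * (y * y) by ring.
by rewrite Ex Ey; ring.
Qed.

Definition idem_zero := Idem idem_zero_subproof.
Definition idem_add e f := Idem (idem_add_subproof e f).

Fact idem_addC : commutative idem_add.
Proof. by move=> e f; apply: val_inj => /=; ring. Qed.

Fact idem_add0 : left_id idem_zero idem_add.
Proof. by move=> e; apply: val_inj => /=; ring. Qed.

Fact idem_addA : associative idem_add.
Proof. by move=> e f g; apply: val_inj => /=; ring. Qed.

Fact idem_addN : left_inverse idem_zero id idem_add.
Proof.
move=> e; apply: val_inj => /=.
by rewrite -mulrA [X in 2%:R * X](idemE e) /=; ring.
Qed.

(* The sum of [idem R] is [e + f - 2 * e * f], not the sum of [R]. *)
HB.instance Definition _ :=
  GRing.isZmodule.Build idem idem_addA idem_addC idem_add0 idem_addN.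

End Idempotents.

Section GrothendieckRing.
Variable S : comPzSemiRingType.
Implicit Types x y z : S * S.

Definition groth_rel : rel (S * S) :=
  fun x y => `[< exists k : S, x.1 + y.2 + k = y.1 + x.2 + k >].

Fact groth_rel_refl : reflexive groth_rel.
Proof. by move=> x; apply/asboolP; exists 0. Qed.

Fact groth_rel_sym : symmetric groth_rel.
Proof. by move=> x y; apply/asboolP/asboolP => -[k E]; exists k. Qed.

Fact groth_rel_trans : transitive groth_rel.
Proof.
move=> y x z /asboolP[k E] /asboolP[l F]; apply/asboolP.
exists (y.1 + y.2 + k + l).
transitivity ((x.1 + y.2 + k) + (y.1 + z.2 + l)); first by ring.
by rewrite E F; ring.
Qed.

Canonical groth_equiv :=
  EquivRel groth_rel groth_rel_refl groth_rel_sym groth_rel_trans.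

(* The class of [(a, b)] is the formal difference [a - b]. *)
Definition groth := {eq_quot groth_rel}.
HB.instance Definition _ := EqQuotient.on groth.
HB.instance Definition _ := Choice.on groth.

Lemma groth_eqP x y :
  reflect (exists k : S, x.1 + y.2 + k = y.1 + x.2 + k)
          (\pi_groth x == \pi_groth y).
Proof. by rewrite eqmodE; apply: asboolP. Qed.

Lemma groth_reprP x :
  exists k : S, (repr (\pi_groth x)).1 + x.2 + k
              = x.1 + (repr (\pi_groth x)).2 + k.
Proof. by apply/groth_eqP; rewrite reprK. Qed.

Implicit Types u v w : groth.

Definition groth_zero : groth := \pi_groth (0, 0).
Definition groth_one : groth := \pi_groth (1, 0).
Definition groth_opp u : groth := \pi_groth ((repr u).2, (repr u).1).
Definition groth_add u v : groth :=
  \pi_groth ((repr u).1 + (repr v).1, (repr u).2 + (repr v).2).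
Definition groth_mul u v : groth :=
  \pi_groth ((repr u).1 * (repr v).1 + (repr u).2 * (repr v).2,
       (repr u).1 * (repr v).2 + (repr u).2 * (repr v).1).

Lemma groth_oppE x : groth_opp (\pi_groth x) = \pi_groth (x.2, x.1).
Proof.
apply/eqP/groth_eqP; have [k E] := groth_reprP x; exists k => /=.
rewrite [LHS](_ : _ = x.1 + (repr (\pi_groth x)).2 + k); last by ring.
by rewrite -E; ring.
Qed.

Lemma groth_addE x y :
  groth_add (\pi_groth x) (\pi_groth y) = \pi_groth (x.1 + y.1, x.2 + y.2).
Proof.
apply/eqP/groth_eqP; have [k E] := groth_reprP x; have [l F] := groth_reprP y.
exists (k + l) => /=; move: E F; set a := repr _; set b := repr _ => E F.
transitivity ((a.1 + x.2 + k) + (b.1 + y.2 + l)); first by ring.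
by rewrite E F; ring.
Qed.

Lemma groth_mulE x y :
  groth_mul (\pi_groth x) (\pi_groth y)
  = \pi_groth (x.1 * y.1 + x.2 * y.2, x.1 * y.2 + x.2 * y.1).
Proof.
have [k E] := groth_reprP x; have [l F] := groth_reprP y.
rewrite /groth_mul; move: E F; set a := repr _; set b := repr _ => E F.
transitivity (\pi_groth (x.1 * b.1 + x.2 * b.2, x.1 * b.2 + x.2 * b.1)).
  apply/eqP/groth_eqP; exists (k * b.1 + k * b.2) => /=.
  transitivity ((a.1 + x.2 + k) * b.1 + (x.1 + a.2 + k) * b.2); first by ring.
  by rewrite -E {1}E; ring.
apply/eqP/groth_eqP; exists (l * x.1 + l * x.2) => /=.
transitivity ((b.1 + y.2 + l) * x.1 + (y.1 + b.2 + l) * x.2); first by ring.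
by rewrite -F {1}F; ring.
Qed.

Fact groth_addA : associative groth_add.
Proof.
elim/quotW=> x; elim/quotW=> y; elim/quotW=> z.
rewrite (groth_addE y z) (groth_addE x y) !groth_addE /=.
by rewrite !addrA.
Qed.

Fact groth_addC : commutative groth_add.
Proof.
elim/quotW=> x; elim/quotW=> y; rewrite !groth_addE /=.
by rewrite (addrC x.1) (addrC x.2).
Qed.

Fact groth_add0 : left_id groth_zero groth_add.
Proof. by elim/quotW=> -[a b]; rewrite groth_addE /= !add0r. Qed.

Fact groth_addN : left_inverse groth_zero groth_opp groth_add.
Proof.
elim/quotW=> x; rewrite groth_oppE groth_addE /=.
by apply/eqP/groth_eqP; exists 0 => /=; ring.
Qed.

HB.instance Definition _ :=
  GRing.isZmodule.Build groth groth_addA groth_addC groth_add0 groth_addN.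

Fact groth_mulA : associative groth_mul.
Proof.
elim/quotW=> x; elim/quotW=> y; elim/quotW=> z.
rewrite (groth_mulE y z) (groth_mulE x y) !groth_mulE /=.
by congr (\pi_groth (_, _)); ring.
Qed.

Fact groth_mulC : commutative groth_mul.
Proof.
elim/quotW=> x; elim/quotW=> y; rewrite !groth_mulE /=.
by congr (\pi_groth (_, _)); ring.
Qed.

Fact groth_mul1 : left_id groth_one groth_mul.
Proof.
elim/quotW=> -[a b]; rewrite groth_mulE /=.
by congr (\pi_groth (_, _)); ring.
Qed.

Fact groth_mulDl : left_distributive groth_mul +%R.
Proof.
elim/quotW=> x; elim/quotW=> y; elim/quotW=> z.
rewrite (groth_mulE x z) (groth_mulE y z) [_ + _](groth_addE x y).
rewrite [RHS]groth_addE groth_mulE /=.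
by congr (\pi_groth (_, _)); ring.
Qed.

HB.instance Definition _ :=
  GRing.Zmodule_isComPzRing.Build groth
    groth_mulA groth_mulC groth_mul1 groth_mulDl.

Definition to_groth (s : S) : groth := \pi_groth (s, 0).

End GrothendieckRing.

Section Modules.
Variable A : comPzRingType.
Implicit Types F L M N P Q : lmodType A.

Definition mk_linear M N (f : M -> N) (fl : linear f) : {linear M -> N} :=
  HB.pack f (GRing.isLinear.Build A M N *:%R f fl).

Definition mod_iso M N := exists f : {linear M -> N}, bijective f.

Definition fin_generated M :=
  exists (n : nat) (v : 'I_n -> M),
    forall x, exists c : 'I_n -> A, x = \sum_i c i *: v i.

Definition projective P :=
  forall M N (g : {linear M -> N}) (f : {linear P -> N}),
    (forall y, exists x, g x = y) ->
    exists h : {linear P -> M}, forall x, g (h x) = f x.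

Lemma mod_isoI M N (f : M -> N) (g : N -> M) :
  linear f -> cancel f g -> cancel g f -> mod_iso M N.
Proof. by move=> fl fK gK; exists (mk_linear fl), g. Qed.

Lemma mod_iso_refl M : mod_iso M M.
Proof. by exists idfun, idfun. Qed.

Lemma mod_iso_sym M N : mod_iso M N -> mod_iso N M.
Proof.
move=> [f [g fK gK]]; apply: (@mod_isoI _ _ g f) => // a x y.
by apply: (can_inj fK); rewrite linearP !gK.
Qed.

Lemma mod_iso_trans N M P : mod_iso M N -> mod_iso N P -> mod_iso M P.
Proof. by move=> [f bf] [g bg]; exists (g \o f); exact: bij_comp. Qed.

Lemma factor_surj F M N (p : {linear F -> M}) (q : {linear F -> N}) :
  (forall y, exists x, p x = y) -> (forall x, p x = 0 -> q x = 0) ->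
  exists h : {linear M -> N}, forall x, h (p x) = q x.
Proof.
move=> ps pq; pose s y := projT1 (cid (ps y)).
have sK y : p (s y) = y by rewrite /s; case: cid.
have E x y : p x = p y -> q x = q y.
  by move=> xy; have := pq (x - y); rewrite !raddfB /= xy subrr => /(_ erefl)/subr0_eq.
have hl : linear (fun y => q (s y)).
  by move=> a x y; rewrite -linearP; apply: E; rewrite linearP /= !sK.
by exists (mk_linear hl) => x /=; apply: E; rewrite sK.
Qed.

Lemma row_sum_linear n M (v : 'I_n -> M) :
  linear (fun c : 'rV[A]_n => \sum_i c 0 i *: v i).
Proof.
move=> a c d; rewrite scaler_sumr -big_split; apply: eq_bigr => i _ /=.
by rewrite !mxE scalerDl scalerA.
Qed.

Lemma fin_generatedP M :
  fin_generated M ->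
  exists n (p : {linear 'rV[A]_n -> M}), forall y, exists x, p x = y.
Proof.
move=> [n [v vP]]; exists n, (mk_linear (row_sum_linear v)) => y.
have [c ->] := vP y; exists (\row_i c i) => /=.
by apply: eq_bigr => i _; rewrite mxE.
Qed.

Definition dual_basis (I : finType) M (v : I -> M)
    (phi : I -> {linear M -> A^o}) :=
  forall x, x = \sum_i (phi i x : A) *: v i.

Lemma fgp_dual_basis M :
  fin_generated M -> projective M ->
  exists n (v : 'I_n -> M) phi, dual_basis v phi.
Proof.
move=> [n [v vP]] Mp.
have [|h hP] := Mp _ _ (mk_linear (row_sum_linear v)) idfun.
  move=> y; have [c ->] := vP y; exists (\row_i c i) => /=.
  by apply: eq_bigr => i _; rewrite mxE.
have phil i : linear (fun x => h x 0 i : A^o).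
  by move=> a x y; rewrite linearP /= !mxE.
by exists n, v, (fun i => mk_linear (phil i)) => x; rewrite -[LHS](hP x).
Qed.

Lemma dual_basis_fgp (I : finType) M (v : I -> M) phi :
  dual_basis v phi -> fin_generated M /\ projective M.
Proof.
move=> vP; split.
  exists #|I|, (fun i => v (enum_val i)) => x.
  exists (fun i => phi (enum_val i) x); rewrite {1}(vP x).
  by rewrite (reindex _ (onW_bij _ (enum_val_bij I))).
move=> N N' g f gs; pose w i := projT1 (cid (gs (f (v i)))).
have wP i : g (w i) = f (v i) by rewrite /w; case: cid.
have hl : linear (fun x => \sum_i (phi i x : A) *: w i).
  move=> a x y; rewrite scaler_sumr -big_split; apply: eq_bigr => i _ /=.
  by rewrite linearP /= scalerDl scalerA.
exists (mk_linear hl) => x /=; rewrite linear_sum {2}(vP x) linear_sum /=.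
by apply: eq_bigr => i _; rewrite !linearZ /= wP.
Qed.

Lemma regular_fgp : fin_generated A^o /\ projective A^o.
Proof.
apply: (@dual_basis_fgp 'I_1 A^o (fun=> 1) (fun=> idfun)) => x.
by rewrite big_ord1 /= -[LHS]mulr1.
Qed.

Lemma zero_fgp : fin_generated 'rV[A]_0 /\ projective 'rV[A]_0.
Proof.
apply: (@dual_basis_fgp 'I_0 'rV[A]_0 (fun=> 0) (fun=> \0)) => x.
by rewrite big_ord0; apply/rowP => -[].
Qed.

Lemma prod_fgp M N :
  fin_generated M /\ projective M -> fin_generated N /\ projective N ->
  fin_generated (M * N)%type /\ projective (M * N)%type.
Proof.
move=> [/fgp_dual_basis Mg /Mg {Mg} [m [v [phi vP]]]].
move=> [/fgp_dual_basis Ng /Ng {Ng} [n [w [psi wP]]]].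
pose u (i : 'I_m + 'I_n) : M * N :=
  match i with inl j => (v j, 0) | inr k => (0, w k) end.
pose chi (i : 'I_m + 'I_n) : {linear (M * N)%type -> A^o} :=
  match i with inl j => phi j \o fst | inr k => psi k \o snd end.
apply: (@dual_basis_fgp _ _ u chi) => -[x y].
rewrite big_sumType [RHS]surjective_pairing; congr (_, _).
  rewrite raddfD !raddf_sum /= [X in _ + X]big1 ?addr0 // => i _.
  exact: scaler0.
rewrite raddfD !raddf_sum /= [X in X + _]big1 ?add0r // => i _.
exact: scaler0.
Qed.

End Modules.

Section Tensor.
Variables (A : comPzRingType) (M N : lmodType A).
Implicit Types L : lmodType A.

(* The [{bilinear _ -> _ -> _}] of mathcomp requires a nonzero ring. *)
Definition bilin (L : lmodType A) (b : M -> N -> L) : Prop :=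
  (forall y, linear (b^~ y)) /\ (forall x, linear (b x)).

Definition formal_eval (L : lmodType A) (b : M -> N -> L) (s : seq (M * N)) :=
  \sum_(p <- s) b p.1 p.2.

(* A list [:: (x1, y1); (x2, y2); ...] stands for the formal sum of the
   xi (x) yi; no scalars are needed, as a (x (x) y) = (a x) (x) y.  Two such
   sums are equal in the tensor product iff every bilinear map identifies
   them; [tensor_univ] is the resulting universal property. *)
Definition tensor_rel : rel (seq (M * N)) := fun s t =>
  `[< forall (L : lmodType A) (b : M -> N -> L),
        bilin b -> formal_eval b s = formal_eval b t >].

Fact tensor_rel_refl : reflexive tensor_rel.
Proof. by move=> s; apply/asboolP. Qed.

Fact tensor_rel_sym : symmetric tensor_rel.
Proof. by move=> s t; apply/asboolP/asboolP => E L b /E. Qed.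

Fact tensor_rel_trans : transitive tensor_rel.
Proof.
move=> t s u /asboolP E /asboolP F; apply/asboolP => L b bl.
by rewrite E ?F.
Qed.

Canonical tensor_equiv :=
  EquivRel tensor_rel tensor_rel_refl tensor_rel_sym tensor_rel_trans.

Definition tensor := {eq_quot tensor_rel}.
HB.instance Definition _ := EqQuotient.on tensor.
HB.instance Definition _ := Choice.on tensor.

Definition tensor_eval (L : lmodType A) (b : M -> N -> L) (u : tensor) :=
  formal_eval b (repr u).

Lemma tensor_evalE L (b : M -> N -> L) s :
  bilin b -> tensor_eval b (\pi_tensor s) = formal_eval b s.
Proof.
have /eqmodP/asboolP E := reprK (\pi_tensor s).
exact: E.
Qed.

Lemma tensor_eq (u v : tensor) :
  (forall (L : lmodType A) (b : M -> N -> L),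
     bilin b -> tensor_eval b u = tensor_eval b v) -> u = v.
Proof.
by move=> E; rewrite -[u]reprK -[v]reprK; apply/eqmodP/asboolP => L b /E.
Qed.

Definition tensor_zero : tensor := \pi_tensor [::].
Definition tensor_add (u v : tensor) : tensor :=
  \pi_tensor (repr u ++ repr v).
Definition tensor_scale (a : A) (u : tensor) : tensor :=
  \pi_tensor [seq (a *: p.1, p.2) | p <- repr u].
Definition tensor_opp (u : tensor) : tensor := tensor_scale (-1) u.

Section Eval.
Variables (L : lmodType A) (b : M -> N -> L).
Hypothesis bl : bilin b.

Lemma tensor_eval0 : tensor_eval b tensor_zero = 0.
Proof. by rewrite tensor_evalE // /formal_eval big_nil. Qed.

Lemma tensor_evalD u v :
  tensor_eval b (tensor_add u v) = tensor_eval b u + tensor_eval b v.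
Proof. by rewrite tensor_evalE // /formal_eval big_cat. Qed.

Lemma tensor_evalZ a u :
  tensor_eval b (tensor_scale a u) = a *: tensor_eval b u.
Proof.
rewrite tensor_evalE // /formal_eval big_map scaler_sumr.
apply: eq_bigr => -[x y] _ /=.
exact: (scalable_linear (bl.1 y)).
Qed.

Lemma tensor_evalN u : tensor_eval b (tensor_opp u) = - tensor_eval b u.
Proof. by rewrite tensor_evalZ scaleN1r. Qed.

End Eval.

Fact tensor_addA : associative tensor_add.
Proof.
by move=> u v w; apply: tensor_eq => L b bl; rewrite !tensor_evalD // addrA.
Qed.

Fact tensor_addC : commutative tensor_add.
Proof.
by move=> u v; apply: tensor_eq => L b bl; rewrite !tensor_evalD // addrC.
Qed.

Fact tensor_add0 : left_id tensor_zero tensor_add.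
Proof.
move=> u; apply: tensor_eq => L b bl.
by rewrite tensor_evalD // tensor_eval0 // add0r.
Qed.

Fact tensor_addN : left_inverse tensor_zero tensor_opp tensor_add.
Proof.
move=> u; apply: tensor_eq => L b bl.
by rewrite tensor_evalD // tensor_evalN // tensor_eval0 // addNr.
Qed.

HB.instance Definition _ := GRing.isZmodule.Build tensor
  tensor_addA tensor_addC tensor_add0 tensor_addN.

Fact tensor_scaleA a b u :
  tensor_scale a (tensor_scale b u) = tensor_scale (a * b) u.
Proof.
by apply: tensor_eq => L c cl; rewrite !tensor_evalZ // scalerA.
Qed.

Fact tensor_scale1 : left_id 1 tensor_scale.
Proof.
by move=> u; apply: tensor_eq => L c cl; rewrite tensor_evalZ // scale1r.
Qed.

Fact tensor_scaleDr : right_distributive tensor_scale +%R.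
Proof.
move=> a u v; apply: tensor_eq => L c cl.
by rewrite !(tensor_evalZ, tensor_evalD) // scalerDr.
Qed.

Fact tensor_scaleDl u : {morph tensor_scale^~ u : a b / a + b}.
Proof.
move=> a b; apply: tensor_eq => L c cl.
by rewrite !(tensor_evalZ, tensor_evalD) // scalerDl.
Qed.

HB.instance Definition _ := GRing.Zmodule_isLmodule.Build A tensor
  tensor_scaleA tensor_scale1 tensor_scaleDr tensor_scaleDl.

Definition tens (x : M) (y : N) : tensor := \pi_tensor [:: (x, y)].

Lemma tensor_eval_tens L (b : M -> N -> L) x y :
  bilin b -> tensor_eval b (tens x y) = b x y.
Proof. by move=> bl; rewrite tensor_evalE // /formal_eval big_seq1. Qed.

Lemma tens_bilin : bilin tens.
Proof.
split=> [y a x x'|x a y y']; apply: tensor_eq => L b bl;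
  rewrite tensor_evalD // tensor_evalZ // !tensor_eval_tens //.
  exact: bl.1.
exact: bl.2.
Qed.

Lemma tensor_eval_linear L (b : M -> N -> L) :
  bilin b -> linear (tensor_eval b).
Proof. by move=> bl a u v; rewrite tensor_evalD // tensor_evalZ. Qed.

Lemma tensor_sum (u : tensor) : u = \sum_(p <- repr u) tens p.1 p.2.
Proof.
apply: tensor_eq => L b bl; have el := tensor_eval_linear bl.
rewrite -[RHS]/(mk_linear el _) raddf_sum /= {1}/tensor_eval /formal_eval.
by apply: eq_bigr => p _; rewrite tensor_eval_tens.
Qed.

Lemma tensor_ext (L : lmodType A) (f g : {linear tensor -> L}) :
  (forall x y, f (tens x y) = g (tens x y)) -> f =1 g.
Proof.
move=> E u; rewrite [u]tensor_sum !raddf_sum.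
by apply: eq_bigr => p _; apply: E.
Qed.

Lemma tensor_ext_linear (L : lmodType A) (f g : tensor -> L) :
  linear f -> linear g ->
  (forall x y, f (tens x y) = g (tens x y)) -> f =1 g.
Proof. by move=> fl gl; apply: (@tensor_ext _ (mk_linear fl) (mk_linear gl)). Qed.

Lemma tensor_lift (L : lmodType A) (b : M -> N -> L) :
  bilin b -> exists f : {linear tensor -> L}, forall x y, f (tens x y) = b x y.
Proof.
move=> bl; exists (mk_linear (tensor_eval_linear bl)) => x y /=.
exact: tensor_eval_tens.
Qed.

Lemma tensor_univ :
  bilin tens /\
  forall (L : lmodType A) (b : M -> N -> L), bilin b ->
    exists2 f : {linear tensor -> L}, forall x y, f (tens x y) = b x y &
      forall g : {linear tensor -> L},
        (forall x y, g (tens x y) = b x y) -> g =1 f.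
Proof.
split=> [|L b /tensor_lift[f fE]]; first exact: tens_bilin.
by exists f => // g gE; apply: tensor_ext => x y; rewrite gE fE.
Qed.

End Tensor.

Arguments tens {A M N} x y.

Section TensorIso.
Variable A : comPzRingType.
Implicit Types L M N P Q : lmodType A.

Lemma lin_id M : linear (fun x : M => x).
Proof. by []. Qed.

Lemma lin_comp L M N (f : M -> N) (g : L -> M) :
  linear f -> linear g -> linear (fun x => f (g x)).
Proof. by move=> fl gl a x y; rewrite gl fl. Qed.

Lemma lin_pair L M N (f : L -> M) (g : L -> N) :
  linear f -> linear g -> linear (fun x => (f x, g x)).
Proof. by move=> fl gl a x y; rewrite fl gl. Qed.

Lemma lin_add L M (f g : L -> M) :
  linear f -> linear g -> linear (fun x => f x + g x).
Proof. by move=> fl gl a x y; rewrite fl gl scalerDr addrACA. Qed.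

Lemma lin_fst M N : linear (fun x : (M * N)%type => x.1).
Proof. by []. Qed.

Lemma lin_snd M N : linear (fun x : (M * N)%type => x.2).
Proof. by []. Qed.

Lemma lin_zero M N : linear (fun _ : M => 0 : N).
Proof. by move=> a x y; rewrite scaler0 addr0. Qed.

Lemma lin_val M N (f : {linear M -> N}) : linear f.
Proof. by move=> a x y; rewrite linearP. Qed.

Lemma tens_linl M N L (f : L -> M) (y : N) :
  linear f -> linear (fun x => tens (f x) y).
Proof. by move=> fl; exact: (lin_comp ((tens_bilin M N).1 y) fl). Qed.

Lemma tens_linr M N L (f : L -> N) (x : M) :
  linear f -> linear (fun y => tens x (f y)).
Proof. by move=> fl; exact: (lin_comp ((tens_bilin M N).2 x) fl). Qed.

Lemma tens0l M N (y : N) : tens (0 : M) y = 0.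
Proof. exact: (raddf0 (mk_linear ((tens_bilin M N).1 y))). Qed.

Lemma tens0r M N (x : M) : tens x (0 : N) = 0.
Proof. exact: (raddf0 (mk_linear ((tens_bilin M N).2 x))). Qed.

Lemma tens_suml M N (I : finType) (F : I -> M) (y : N) :
  tens (\sum_i F i) y = \sum_i tens (F i) y.
Proof. exact: (raddf_sum (mk_linear ((tens_bilin M N).1 y))). Qed.

Lemma tens_sumr M N (I : finType) (F : I -> N) (x : M) :
  tens x (\sum_i F i) = \sum_i tens x (F i).
Proof. exact: (raddf_sum (mk_linear ((tens_bilin M N).2 x))). Qed.

Lemma tensZl M N a (x : M) (y : N) : tens (a *: x) y = a *: tens x y.
Proof. exact: (linearZ_LR (mk_linear ((tens_bilin M N).1 y))). Qed.

Lemma tensZr M N a (x : M) (y : N) : tens x (a *: y) = a *: tens x y.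
Proof. exact: (linearZ_LR (mk_linear ((tens_bilin M N).2 x))). Qed.

Lemma lin_param M N P L (b : L -> M -> N -> P) (u : tensor M N) :
  (forall x y, linear (fun z => b z x y)) ->
  linear (fun z => tensor_eval (b z) u).
Proof.
move=> bl a z z'; rewrite /tensor_eval /formal_eval scaler_sumr -big_split.
by apply: eq_bigr => p _ /=; rewrite bl.
Qed.

Definition tmap M N M' N' (f : M -> M') (g : N -> N') : tensor M N -> tensor M' N' :=
  tensor_eval (fun x y => tens (f x) (g y)).

Lemma tmap_bilin M N M' N' (f : M -> M') (g : N -> N') :
  linear f -> linear g -> bilin (fun x y => tens (f x) (g y)).
Proof. by move=> fl gl; split=> z; [exact: tens_linl|exact: tens_linr]. Qed.

Lemma tmap_linear M N M' N' (f : M -> M') (g : N -> N') :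
  linear f -> linear g -> linear (tmap f g).
Proof. by move=> fl gl; apply/tensor_eval_linear/tmap_bilin. Qed.

Lemma tmap_tens M N M' N' (f : M -> M') (g : N -> N') x y :
  linear f -> linear g -> tmap f g (tens x y) = tens (f x) (g y).
Proof. by move=> fl gl; apply/tensor_eval_tens/tmap_bilin. Qed.

Lemma tensor_iso M M' N N' :
  mod_iso M M' -> mod_iso N N' -> mod_iso (tensor M N) (tensor M' N').
Proof.
have can_linear P Q (f : P -> Q) g :
    linear f -> cancel f g -> cancel g f -> linear g.
  by move=> fl fK gK a x y; apply: (can_inj fK); rewrite fl !gK.
move=> [f [f' fK f'K]] [g [g' gK g'K]].
have fl := lin_val f; have gl := lin_val g.
have f'l : linear f' by apply: (can_linear _ _ f).
have g'l : linear g' by apply: (can_linear _ _ g).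
apply: (@mod_isoI _ _ _ (tmap f g) (tmap f' g')).
- exact: tmap_linear.
- apply: (tensor_ext_linear (lin_comp _ _) (@lin_id _));
    do ?exact: tmap_linear.
  by move=> x y; rewrite !tmap_tens // fK gK.
apply: (tensor_ext_linear (lin_comp _ _) (@lin_id _));
  do ?exact: tmap_linear.
by move=> x y; rewrite !tmap_tens // f'K g'K.
Qed.

Lemma tensorC_iso M N : mod_iso (tensor M N) (tensor N M).
Proof.
have bl P Q : bilin (fun (x : P) (y : Q) => tens y x).
  by split=> z; [apply: tens_linr|apply: tens_linl]; exact: lin_id.
have el P Q := tensor_eval_linear (bl P Q).
apply: (mod_isoI (el _ _) (g := tensor_eval (fun x y => tens y x))).
- apply: (tensor_ext_linear (lin_comp (el _ _) (el _ _)) (@lin_id _)) => x y.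
  by rewrite !tensor_eval_tens.
apply: (tensor_ext_linear (lin_comp (el _ _) (el _ _)) (@lin_id _)) => x y.
by rewrite !tensor_eval_tens.
Qed.

Lemma tensorA_iso M N P :
  mod_iso (tensor M (tensor N P)) (tensor (tensor M N) P).
Proof.
pose b x w := tensor_eval (fun (y : N) (z : P) => tens (tens (x : M) y) z) w.
have b1 x : bilin (fun (y : N) (z : P) => tens (tens (x : M) y) z).
  split=> t; last exact/tens_linr/lin_id.
  exact/tens_linl/tens_linr/lin_id.
have bl : bilin b.
  split=> [w|x]; last exact: tensor_eval_linear.
  apply: lin_param => y z; exact/tens_linl/tens_linl/lin_id.
pose c w z := tensor_eval (fun (x : M) (y : N) => tens x (tens y (z : P))) w.
have c1 z : bilin (fun (x : M) (y : N) => tens x (tens y (z : P))).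
  split=> t; first exact/tens_linl/lin_id.
  exact/tens_linr/tens_linl/lin_id.
have cl : bilin c.
  split=> [z|w]; first exact: tensor_eval_linear.
  apply: lin_param => x y; exact/tens_linr/tens_linr/lin_id.
have fl := tensor_eval_linear bl; have gl := tensor_eval_linear cl.
apply: (mod_isoI fl (g := tensor_eval c)).
- apply: (tensor_ext_linear (lin_comp gl fl) (@lin_id _)) => x w.
  rewrite tensor_eval_tens //; move: w.
  apply: tensor_ext_linear; first exact/lin_comp/(bl.2 x).
    exact/tens_linr/lin_id.
  by move=> y z; rewrite /b /c !tensor_eval_tens.
apply: (tensor_ext_linear (lin_comp fl gl) (@lin_id _)) => w z.
rewrite tensor_eval_tens //; move: w.
apply: tensor_ext_linear; first exact: (lin_comp fl (cl.1 z)).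
  exact/tens_linl/lin_id.
by move=> x y; rewrite /b /c !tensor_eval_tens.
Qed.

Lemma tensor1_iso M : mod_iso (tensor A^o M) M.
Proof.
have bl : bilin (fun (a : A^o) (x : M) => (a : A) *: x).
  split=> [x c a b|a c x y]; first by rewrite scalerDl scalerA.
  by rewrite scalerDr !scalerA mulrC.
have el := tensor_eval_linear bl.
have il : linear (tens (1 : A^o) : M -> _) by exact/tens_linr/lin_id.
apply: (mod_isoI el (g := tens (1 : A^o))) => [|x].
  apply: (tensor_ext_linear (lin_comp il el) (@lin_id _)) => a x.
  rewrite tensor_eval_tens // tensZr -tensZl.
  by congr (tens _ _); rewrite -[RHS]mulr1.
by rewrite tensor_eval_tens // scale1r.
Qed.

Lemma tensorDl_iso M N P :
  mod_iso (tensor (M * N)%type P) (tensor M P * tensor N P)%type.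
Proof.
pose b (v : (M * N)%type) (z : P) := (tens v.1 z, tens v.2 z).
have bl : bilin b.
  split=> z; last exact: lin_pair (tens_linr _ (@lin_id _)) (tens_linr _ (@lin_id _)).
  exact: lin_pair (tens_linl _ (@lin_fst _ _)) (tens_linl _ (@lin_snd _ _)).
have el := tensor_eval_linear bl.
pose i (x : M) : (M * N)%type := (x, 0); pose j (y : N) : (M * N)%type := (0, y).
have il : linear i := lin_pair (@lin_id _) (@lin_zero _ _).
have jl : linear j := lin_pair (@lin_zero _ _) (@lin_id _).
have Pl := @lin_id P.
pose g (w : (tensor M P * tensor N P)%type) := tmap i id w.1 + tmap j id w.2.
have gl : linear g.
  apply: lin_add; apply: lin_comp; rewrite ?tmap_linear //;
    by [exact: tmap_linear|exact: lin_fst|exact: lin_snd].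
apply: (mod_isoI el (g := g)).
- apply: (tensor_ext_linear (lin_comp gl el) (@lin_id _)) => -[x y] z.
  rewrite tensor_eval_tens // /g /= !tmap_tens // /i /j.
  rewrite -[LHS](raddfD (mk_linear (tens_linl z (@lin_id (M * N)%type)))) /=.
  by congr (tens _ _); congr (_, _); rewrite ?addr0 ?add0r.
have E1 u : tensor_eval b (tmap i id u) = (u, 0).
  move: u; apply: tensor_ext_linear.
  - exact: (lin_comp el (tmap_linear il Pl)).
  - exact: lin_pair (@lin_id _) (@lin_zero _ _).
  by move=> x z; rewrite tmap_tens // tensor_eval_tens // /b /= tens0l.
have E2 u : tensor_eval b (tmap j id u) = (0, u).
  move: u; apply: tensor_ext_linear.
  - exact: (lin_comp el (tmap_linear jl Pl)).
  - exact: lin_pair (@lin_zero _ _) (@lin_id _).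
  by move=> x z; rewrite tmap_tens // tensor_eval_tens // /b /= tens0l.
move=> [u v]; rewrite /g /= [LHS](raddfD (mk_linear el)) /= E1 E2.
by congr (_, _); rewrite ?addr0 ?add0r.
Qed.

Lemma tensor0_iso M : mod_iso (tensor 'rV[A]_0 M) 'rV[A]_0.
Proof.
apply: (@mod_isoI _ _ _ (fun=> 0) (fun=> 0)); first exact: lin_zero.
- apply: (tensor_ext_linear (@lin_zero _ _) (@lin_id _)) => x y.
  by rewrite (_ : x = 0) ?tens0l //; apply/rowP => -[].
by move=> x; apply/rowP => -[].
Qed.

Lemma prod_iso M M' N N' :
  mod_iso M M' -> mod_iso N N' -> mod_iso (M * N)%type (M' * N')%type.
Proof.
move=> [f [f' fK f'K]] [g [g' gK g'K]].
apply: (@mod_isoI _ _ _ (fun v => (f v.1, g v.2)) (fun v => (f' v.1, g' v.2))).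
- by move=> a x y; rewrite /= !linearP.
- by case=> x y /=; rewrite fK gK.
by case=> x y /=; rewrite f'K g'K.
Qed.

Lemma prodC_iso M N : mod_iso (M * N)%type (N * M)%type.
Proof.
by apply: (@mod_isoI _ _ _ (fun v => (v.2, v.1)) (fun v => (v.2, v.1))) => // -[].
Qed.

Lemma prodA_iso M N P :
  mod_iso (M * (N * P))%type ((M * N)%type * P)%type.
Proof.
by apply: (@mod_isoI _ _ _ (fun v => ((v.1, v.2.1), v.2.2))
  (fun v => (v.1.1, (v.1.2, v.2)))) => // [[x []]|[[]]].
Qed.

Lemma prod0_iso M : mod_iso ('rV[A]_0 * M)%type M.
Proof.
apply: (@mod_isoI _ _ _ (fun v => v.2) (fun x => (0, x))) => // -[x y].
by congr (_, _); apply/rowP => -[].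
Qed.

Lemma tensor_fgp M N :
  fin_generated M /\ projective M -> fin_generated N /\ projective N ->
  fin_generated (tensor M N) /\ projective (tensor M N).
Proof.
move=> [/fgp_dual_basis Mg /Mg {Mg} [m [v [phi vP]]]].
move=> [/fgp_dual_basis Ng /Ng {Ng} [n [w [psi wP]]]].
pose b i j (x : M) (y : N) : A^o := (phi i x : A) * (psi j y : A).
have bl i j : bilin (b i j).
  split=> [y a x x'|x a y y']; rewrite /b linearP /=.
    by rewrite mulrDl -mulrA.
  by rewrite mulrDr mulrCA.
pose e (p : 'I_m * 'I_n) := tens (v p.1) (w p.2).
pose chi (p : 'I_m * 'I_n) := mk_linear (tensor_eval_linear (bl p.1 p.2)).
apply: (@dual_basis_fgp _ _ _ e chi).
apply: tensor_ext_linear; first exact: lin_id.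
  move=> a u u'; rewrite scaler_sumr -big_split; apply: eq_bigr => i _ /=.
  rewrite scalerA -scalerDl; congr (_ *: _).
  exact: (tensor_eval_linear (bl i.1 i.2)).
move=> x y; rewrite {1}(vP x) {1}(wP y) tens_suml.
rewrite -(pair_bigA _ (fun i j => (chi (i, j) (tens x y) : A) *: e (i, j))) /=.
apply: eq_bigr => i _; rewrite tens_sumr; apply: eq_bigr => j _.
by rewrite tensZl tensZr scalerA tensor_eval_tens.
Qed.

End TensorIso.

Section IsoClasses.
Variable A : comPzRingType.

Record fgpModule := FgpModule {
  fgp_sort :> lmodType A;
  fgpP : fin_generated fgp_sort /\ projective fgp_sort
}.

Implicit Types M N P : fgpModule.

(* [presentation M n K] : [K] is the kernel of a linear surjection from A^n
   onto M.  The family of all kernels of such surjections is a complete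
   isomorphism invariant of finitely generated modules (see [cls_eqP]).  It
   lives in the universe of [A], unlike a quotient of the type of all modules,
   so that isomorphism classes can carry mathcomp ring structures. *)
Definition presentation (M : lmodType A) (n : nat) (K : 'rV[A]_n -> Prop) :=
  exists p : {linear 'rV[A]_n -> M},
    (forall y, exists x, p x = y) /\ (forall x, K x <-> p x = 0).

Record isoclass := IsoClass {
  isoclass_val : forall n, ('rV[A]_n -> Prop) -> Prop;
  isoclassP : exists M : fgpModule, isoclass_val = presentation M
}.

HB.instance Definition _ := gen_eqMixin isoclass.
HB.instance Definition _ := gen_choiceMixin isoclass.

Definition cls M : isoclass := IsoClass (ex_intro _ M erefl).

Definition rep (c : isoclass) : fgpModule := projT1 (cid (isoclassP c)).

Lemma isoclass_inj c d : isoclass_val c = isoclass_val d -> c = d.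
Proof.
case: c d => [c cP] [d dP] /= E; rewrite -E in dP *.
by rewrite (Prop_irrelevance cP dP).
Qed.

Lemma repK c : cls (rep c) = c.
Proof. by apply: isoclass_inj; rewrite /rep /=; case: cid. Qed.

Lemma presentation_iso (M N : lmodType A) n (K : 'rV[A]_n -> Prop) :
  mod_iso M N -> presentation M K -> presentation N K.
Proof.
move=> [f bf] [p [ps pK]]; exists (f \o p); split=> [y|x].
  by have [g _ gK] := bf; have [x xE] := ps (g y); exists x; rewrite /= xE gK.
rewrite pK /=; split=> [->|E]; first exact: raddf0.
by apply: (bij_inj bf); rewrite E raddf0.
Qed.

Lemma cls_eqP M N : cls M = cls N <-> mod_iso M N.
Proof.
split=> [[E]|MN].
  have [n [p ps]] := fin_generatedP (fgpP M).1.
  have pM : presentation M (fun x : 'rV[A]_n => p x = 0).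
    by exists p; split.
  have := pM; rewrite E => -[q [qs qK]].
  have [f fE] := factor_surj ps (fun x => (qK x).1).
  have [g gE] := factor_surj qs (fun x => (qK x).2).
  exists f, g => [x|y]; first by have [z <-] := ps x; rewrite fE gE.
  by have [z <-] := qs y; rewrite gE fE.
apply: isoclass_inj; apply: functional_extensionality_dep => n; apply: funext => K.
apply: propext; split; apply: presentation_iso => //; exact: mod_iso_sym.
Qed.

Definition zero_mod : fgpModule := FgpModule (zero_fgp A).
Definition unit_mod : fgpModule := FgpModule (regular_fgp A).
Definition prod_mod M N : fgpModule := FgpModule (prod_fgp (fgpP M) (fgpP N)).
Definition tensor_mod M N : fgpModule :=
  FgpModule (tensor_fgp (fgpP M) (fgpP N)).

Implicit Types c d : isoclass.
Definition cls_add c d := cls (prod_mod (rep c) (rep d)).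
Definition cls_mul c d := cls (tensor_mod (rep c) (rep d)).

Lemma rep_cls M : mod_iso (rep (cls M)) M.
Proof. by apply/cls_eqP; rewrite repK. Qed.

Lemma cls_addE M N : cls_add (cls M) (cls N) = cls (prod_mod M N).
Proof. by apply/cls_eqP/prod_iso; exact: rep_cls. Qed.

Lemma cls_mulE M N : cls_mul (cls M) (cls N) = cls (tensor_mod M N).
Proof. by apply/cls_eqP/tensor_iso; exact: rep_cls. Qed.

Lemma cls_ind (T : isoclass -> Prop) : (forall M, T (cls M)) -> forall c, T c.
Proof. by move=> H c; rewrite -[c]repK. Qed.

Fact cls_addA : associative cls_add.
Proof.
elim/cls_ind=> M; elim/cls_ind=> N; elim/cls_ind=> P.
by rewrite (cls_addE N P) (cls_addE M N) !cls_addE; apply/cls_eqP/prodA_iso.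
Qed.

Fact cls_addC : commutative cls_add.
Proof.
elim/cls_ind=> M; elim/cls_ind=> N.
by rewrite !cls_addE; apply/cls_eqP/prodC_iso.
Qed.

Fact cls_add0 : left_id (cls zero_mod) cls_add.
Proof. by elim/cls_ind=> M; rewrite cls_addE; apply/cls_eqP/prod0_iso. Qed.

HB.instance Definition _ :=
  GRing.isNmodule.Build isoclass cls_addA cls_addC cls_add0.

Fact cls_mulA : associative cls_mul.
Proof.
elim/cls_ind=> M; elim/cls_ind=> N; elim/cls_ind=> P.
by rewrite (cls_mulE N P) (cls_mulE M N) !cls_mulE; apply/cls_eqP/tensorA_iso.
Qed.

Fact cls_mulC : commutative cls_mul.
Proof.
elim/cls_ind=> M; elim/cls_ind=> N.
by rewrite !cls_mulE; apply/cls_eqP/tensorC_iso.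
Qed.

Fact cls_mul1 : left_id (cls unit_mod) cls_mul.
Proof. by elim/cls_ind=> M; rewrite cls_mulE; apply/cls_eqP/tensor1_iso. Qed.

Fact cls_mulDl : left_distributive cls_mul +%R.
Proof.
elim/cls_ind=> M; elim/cls_ind=> N; elim/cls_ind=> P.
rewrite (cls_mulE M P) (cls_mulE N P) [_ + _](cls_addE M N).
by rewrite [RHS]cls_addE cls_mulE; apply/cls_eqP/tensorDl_iso.
Qed.

Fact cls_mul0 : left_zero 0 cls_mul.
Proof.
elim/cls_ind=> M; rewrite [0]/(cls zero_mod) cls_mulE.
exact/cls_eqP/tensor0_iso.
Qed.

HB.instance Definition _ := GRing.Nmodule_isComPzSemiRing.Build isoclass
  cls_mulA cls_mulC cls_mul1 cls_mulDl cls_mul0.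

End IsoClasses.

Definition K0 (A : comPzRingType) : comPzRingType := groth (isoclass A).

Definition K0_class (A : comPzRingType) (M : fgpModule A) : K0 A :=
  to_groth (cls M).

Section PrincipalIdeal.
Variables (A : comPzRingType) (a : A).

Definition in_principal : {pred A^o} := fun x => `[< exists b : A, x = b * a >].

Record principal := Principal { principal_val : A^o; _ : in_principal principal_val }.

HB.instance Definition _ := [isSub for principal_val].
HB.instance Definition _ := [Choice of principal by <:].

Fact principal_submod : subsemimod_closed in_principal.
Proof.
split=> [|c x /asboolP[b ->]].
  split=> [|x y /asboolP[b ->] /asboolP[c ->]]; apply/asboolP.
    by exists 0; rewrite mul0r.
  by exists (b + c); rewrite mulrDl.
by apply/asboolP; exists (c * b); rewrite -mulrA.
Qed.

HB.instance Definition _ :=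
  GRing.SubChoice_isSubLmodule.Build A A^o in_principal principal principal_submod.

End PrincipalIdeal.

Lemma principal_idem_fgp (A : comPzRingType) (e : idem A) :
  fin_generated (principal (val e)) /\ projective (principal (val e)).
Proof.
have eP : in_principal (val e) (val e).
  by apply/asboolP; exists 1; rewrite mul1r.
pose phi : {linear principal (val e) -> A^o} := val.
apply: (@dual_basis_fgp _ 'I_1 _ (fun=> Principal eP) (fun=> phi)) => x.
rewrite big_ord1; apply: val_inj; rewrite linearZ /=.
have /asboolP[b ->] := valP x.
by rewrite -[RHS]mulrA; exact: (congr1 ( *%R b) (esym (idemE e))).
Qed.

Definition idem_module (A : comPzRingType) (e : idem A) : fgpModule A :=
  FgpModule (principal_idem_fgp e).

(* Main.v *)
Require Import Defs.
From mathcomp Require Import all_boot all_order all_algebra.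
From HB Require Import structures.
From mathcomp Require Import perm boolp ring zify.

(** Say that f in A kills x in K0(A) if x = [M] - [N] for some M, N with maps
M -> N and N -> M whose two composites are multiplication by f; morally, x
vanishes on the open set D(f).  The Koszul factorization shows that if f kills
x and g kills y, then f + g kills x y; hence the elements killing an
idempotent x form an ideal.  A determinant argument shows that only nilpotent
elements kill a positive integer.

If E is an n x n idempotent matrix with image M, let d_S be the determinant of
the matrix with the rows of E in S and those of 1 - E outside S.  By
multilinearity the d_S add up to det(E + (1 - E)) = 1, and d_S kills
[M] - |S|.  So for every x there are d_i with sum 1 and integers k_i such that
d_i kills x - k_i.  If x is idempotent, then d_i kills k_i (1 - k_i), and is
nilpotent unless k_i is 0 or 1; thus the ideals of the elements killing x and
1 - x are comaximal, and their product is nil as its elements kill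
1 = x + (1 - x).  Lifting idempotents gives e such that 1 - e kills x and e
kills 1 - x.  This relation between idempotents of A and K0(A) determines each
side from the other, is compatible with products and complements, and holds
for e and [A e]. *)

Set Implicit Arguments.
Unset Strict Implicit.
Unset Printing Implicit Defensive.

Import GRing.Theory.
Local Open Scope ring_scope.

(** * Idempotents, nilpotents and comaximal elements of a commutative ring *)

Section CommutativeRing.
Variable R : comPzRingType.
Implicit Types a b e : R.

Lemma idem_compl e :
  e * e = e -> (1 - e) * (1 - e) = 1 - e.
Proof. by move=> ee; rewrite mulrBl mul1r mulrBr mulr1 ee subrr subr0. Qed.

Lemma idem_nilpotent e m : e * e = e -> e ^+ m = 0 -> e = 0.
Proof.
move=> ee; case: m => [|m].
  by rewrite expr0 => e0; rewrite -[e]mulr1 e0 mulr0.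
suff -> : e ^+ m.+1 = e by [].
by elim: m => [|m IHm] //; rewrite exprS IHm ee.
Qed.

Lemma nilpotent_unit a m : a ^+ m = 0 -> exists b, (1 - a) * b = 1.
Proof.
move=> am; exists (\sum_(i < m) a ^+ i).
by apply: oppr_inj; rewrite -mulNr opprB -subrX1 am sub0r.
Qed.

(** If [c + d = 1], then [c] divides [1 - d ^+ n]; applying this twice raises first [b], then [a],
    to the power [n]. *)
Lemma comax_powers a b n : a + b = 1 -> exists s t, a ^+ n * s + b ^+ n * t = 1.
Proof.
have step (c d : R) : c + d = 1 -> exists s, c * s + d ^+ n = 1.
  move=> cd; exists (\sum_(i < n) d ^+ i).
  by rewrite -[c](addrK d) cd -opprB mulNr -subrX1 opprB subrK.
move=> /step[s E]; rewrite addrC in E; have [t F] := step _ _ E.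
by exists (s ^+ n), t; rewrite -exprMn addrC.
Qed.

(** The symmetric difference written with products and complements alone, the two operations that
    [classifies] respects. *)
Lemma idem_addE_compl (e f : idem R) :
  val (e + f) = 1 - (1 - val e * (1 - val f)) * (1 - val f * (1 - val e)).
Proof.
have -> : val (e + f) = val e + val f - 2%:R * val e * val f by [].
move: (idemE e); move: (val e) (val f) => a b aa.
have -> : 1 - (1 - a * (1 - b)) * (1 - b * (1 - a)) =
  a * (1 - b) + b * (1 - a) - (a - a * a) * (b - b * b) by ring.
by rewrite aa subrr mul0r; ring.
Qed.

End CommutativeRing.

(** * The canonical map from a semiring to its Grothendieck ring *)

Section ToGroth.
Variable S : comPzSemiRingType.
Implicit Types s t : S.

Lemma to_groth0 : to_groth 0 = 0 :> groth S.
Proof. by []. Qed.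

Lemma to_groth1 : to_groth 1 = 1 :> groth S.
Proof. by []. Qed.

Lemma to_grothD s t : to_groth (s + t) = to_groth s + to_groth t :> groth S.
Proof. by rewrite [RHS](groth_addE (s, 0) (t, 0)) /= addr0. Qed.

Lemma to_grothM s t : to_groth (s * t) = to_groth s * to_groth t :> groth S.
Proof.
by rewrite [RHS](groth_mulE (s, 0) (t, 0)) /= !mul0r mulr0 !addr0.
Qed.

Lemma to_groth_eq s t :
  to_groth s = to_groth t -> exists k, s + k = t + k.
Proof. by move/eqP/groth_eqP => -[k]; rewrite /= !addr0; exists k. Qed.

Lemma groth_sub (u : groth S) : exists s t, u = to_groth s - to_groth t.
Proof.
elim/quotW: u => -[s t]; exists s, t; apply/eqP; rewrite eq_sym subr_eq.
by rewrite [_ + _](groth_addE (s, t) (t, 0)) /=; apply/eqP/eqP/groth_eqP;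
  exists 0; rewrite /= !addr0.
Qed.

End ToGroth.

(** * Classes of modules in [K0] *)

Section K0Class.
Variable A : comPzRingType.
Implicit Types M N P Q : fgpModule A.

Lemma K0_class_iso M N : mod_iso M N -> K0_class M = K0_class N.
Proof. by move/cls_eqP => E; rewrite /K0_class E. Qed.

Lemma K0_class_zero : K0_class (zero_mod A) = 0.
Proof. exact: to_groth0. Qed.

Lemma K0_class_unit : K0_class (unit_mod A) = 1.
Proof. exact: to_groth1. Qed.

Lemma K0_class_prod M N : K0_class (prod_mod M N) = K0_class M + K0_class N.
Proof. by rewrite -[RHS]to_grothD [_ + _]cls_addE. Qed.

Lemma K0_class_tensor M N :
  K0_class (tensor_mod M N) = K0_class M * K0_class N.
Proof. by rewrite -[RHS]to_grothM [_ * _]cls_mulE. Qed.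

Lemma K0_class_eq M N :
  K0_class M = K0_class N ->
  exists P, mod_iso (M * P)%type (N * P)%type.
Proof.
move=> /to_groth_eq[k]; rewrite -[k]repK => E; exists (rep k).
by apply/(@cls_eqP _ (prod_mod M (rep k)) (prod_mod N (rep k)));
  move: E; rewrite ![_ + _]cls_addE.
Qed.

Lemma K0_sub (x : K0 A) : exists M N, x = K0_class M - K0_class N.
Proof.
by have [s [t ->]] := groth_sub x; exists (rep s), (rep t);
  rewrite /K0_class !repK.
Qed.

Lemma rV_fgp n : fin_generated 'rV[A]_n /\ projective 'rV[A]_n.
Proof.
pose phi (i : 'I_n) := mk_linear (fun a (x y : 'rV[A]_n) =>
  etrans (mxE _ _ 0 i) (congr1 (+%R^~ (y 0 i)) (mxE _ _ 0 i)) :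
  ((a *: x + y) 0 i : A^o) = a *: (x 0 i : A^o) + y 0 i).
apply: (@dual_basis_fgp _ _ _ (delta_mx 0) phi) => x.
exact: row_sum_delta.
Qed.

Definition free_mod n : fgpModule A := FgpModule (rV_fgp n).

Lemma rVS_iso n : mod_iso 'rV[A]_n.+1 (A^o * 'rV[A]_n)%type.
Proof.
apply: (@mod_isoI _ 'rV[A]_(1 + n) (A^o * 'rV[A]_n)%type
  (fun x => (x 0 (lshift n 0), rsubmx x)) (fun y => row_mx y.1%:M y.2)).
- by move=> a x y; rewrite !mxE linearP.
- move=> x /=; rewrite -[RHS]hsubmxK; congr row_mx.
  by rewrite [RHS]mx11_scalar !mxE.
by move=> [a x] /=; rewrite row_mxKr row_mxEl mxE.
Qed.

Lemma K0_class_free n : K0_class (free_mod n) = n%:R.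
Proof.
elim: n => [|n IHn].
  by rewrite mulr0n -K0_class_zero; apply: K0_class_iso; exact: mod_iso_refl.
rewrite -natr1 -IHn -K0_class_unit addrC -K0_class_prod.
exact/K0_class_iso/rVS_iso.
Qed.

End K0Class.

(** * Pairs of maps inverse to each other up to a scalar *)

Section IsoUpTo.
Variable A : comPzRingType.
Implicit Types (f g : A) (L M N P Q : lmodType A).

Definition iso_upto f M N :=
  exists (phi : {linear M -> N}) (psi : {linear N -> M}),
    (forall x, psi (phi x) = f *: x) /\ (forall y, phi (psi y) = f *: y).

Lemma iso_upto_sym f M N : iso_upto f M N -> iso_upto f N M.
Proof. by move=> [phi [psi [E F]]]; exists psi, phi. Qed.

Lemma iso_upto0 M N : iso_upto 0 M N.
Proof. by exists \0, \0; split=> x; rewrite /= scale0r. Qed.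

Lemma iso_upto1 M N : iso_upto 1 M N <-> mod_iso M N.
Proof.
split=> [[phi [psi [E F]]]|[f [g fK gK]]].
  by exists phi, psi => x; rewrite (E, F) scale1r.
have gl : linear g by move=> a x y; apply: (can_inj fK); rewrite linearP !gK.
by exists f, (mk_linear gl); split=> x /=; rewrite (fK, gK) scale1r.
Qed.

Lemma lin_scale f M : linear (fun x : M => f *: x).
Proof. by move=> a x y; rewrite scalerDr !scalerA mulrC. Qed.

Lemma iso_uptoMl a f M N : iso_upto f M N -> iso_upto (a * f) M N.
Proof.
move=> [phi [psi [E F]]].
exists (mk_linear (lin_comp (@lin_scale a _) (lin_val phi))), psi.
by split=> x /=; rewrite ?linearZ /= (E, F) scalerA.
Qed.

Lemma iso_upto_prod f M N M' N' :
  iso_upto f M N -> iso_upto f M' N' ->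
  iso_upto f (M * M')%type (N * N')%type.
Proof.
move=> [phi [psi [E F]]] [phi' [psi' [E' F']]].
have l1 := lin_pair (lin_comp (lin_val phi) (@lin_fst _ M M'))
                    (lin_comp (lin_val phi') (@lin_snd _ M M')).
have l2 := lin_pair (lin_comp (lin_val psi) (@lin_fst _ N N'))
                    (lin_comp (lin_val psi') (@lin_snd _ N N')).
exists (mk_linear l1), (mk_linear l2).
by split=> -[x y] /=; rewrite ?E ?E' ?F ?F'.
Qed.

Lemma tmap_comp M N M' N' M'' N'' (p' : {linear M' -> M''})
    (q' : {linear N' -> N''}) (p : {linear M -> M'}) (q : {linear N -> N'}) u :
  tmap p' q' (tmap p q u) = tmap (p' \o p) (q' \o q) u.
Proof.
have tl L L' P P' (h : {linear L -> L'}) (k : {linear P -> P'}) :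
  linear (tmap h k) := tmap_linear (lin_val h) (lin_val k).
apply: (tensor_ext_linear (lin_comp (tl _ _ _ _ p' q') (tl _ _ _ _ p q))
  (tl _ _ _ _ (p' \o p) (q' \o q))) => x y.
by rewrite !tmap_tens //; exact: lin_val.
Qed.

Lemma tmap_scalel f M N (p : {linear M -> M}) u :
  (forall x, p x = f *: x) -> tmap p (@idfun N) u = f *: u.
Proof.
move=> E; move: u; apply: tensor_ext_linear.
- exact: tmap_linear (lin_val p) (@lin_id _ N).
- exact: lin_scale.
by move=> x y; rewrite tmap_tens ?E ?tensZl //; exact: lin_val.
Qed.

Lemma tmap_scaler f M N (q : {linear N -> N}) u :
  (forall y, q y = f *: y) -> tmap (@idfun M) q u = f *: u.
Proof.
move=> E; move: u; apply: tensor_ext_linear.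
- exact: tmap_linear (@lin_id _ M) (lin_val q).
- exact: lin_scale.
by move=> x y; rewrite tmap_tens ?E ?tensZr //; exact: lin_val.
Qed.

(* The two maps are the 2 x 2 matrices
     [ phi (x) 1 , - 1 (x) psi' ; 1 (x) phi' , psi (x) 1 ] and
     [ psi (x) 1 , 1 (x) psi' ; - 1 (x) phi' , phi (x) 1 ],
   the Koszul factorization of f + g. *)
Lemma iso_upto_tensor f g M N M' N' :
  iso_upto f M N -> iso_upto g M' N' ->
  iso_upto (f + g) (tensor M M' * tensor N N')%type
                   (tensor N M' * tensor M N')%type.
Proof.
move=> [phi [psi [E F]]] [phi' [psi' [E' F']]].
pose T L L' P P' (h : {linear L -> L'}) (k : {linear P -> P'}) :
  {linear tensor L P -> tensor L' P'} :=
  mk_linear (tmap_linear (lin_val h) (lin_val k)).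
have El (K : lmodType A) u :
    T _ _ _ _ psi (@idfun K) (T _ _ _ _ phi idfun u) = f *: u.
  by rewrite [LHS]tmap_comp (tmap_scalel (f := f) (p := psi \o phi)).
have Fl (K : lmodType A) u :
    T _ _ _ _ phi (@idfun K) (T _ _ _ _ psi idfun u) = f *: u.
  by rewrite [LHS]tmap_comp (tmap_scalel (f := f) (p := phi \o psi)).
have Er (K : lmodType A) u :
    T _ _ _ _ (@idfun K) psi' (T _ _ _ _ idfun phi' u) = g *: u.
  by rewrite [LHS]tmap_comp (tmap_scaler (f := g) (q := psi' \o phi')).
have Fr (K : lmodType A) u :
    T _ _ _ _ (@idfun K) phi' (T _ _ _ _ idfun psi' u) = g *: u.
  by rewrite [LHS]tmap_comp (tmap_scaler (f := g) (q := phi' \o psi')).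
(* Maps acting on different tensor factors commute, so the off-diagonal entries of both composites
   cancel. *)
have TC L L' P P' (h : {linear L -> L'}) (k : {linear P -> P'}) u :
  T _ _ _ _ h idfun (T _ _ _ _ idfun k u)
  = T _ _ _ _ idfun k (T _ _ _ _ h idfun u).
  by rewrite [LHS]tmap_comp [RHS]tmap_comp.
clearbody T.
pose Phi1 : {linear (tensor M M' * tensor N N')%type -> tensor N M'} :=
  (T _ _ _ _ phi idfun \o fst) \- (T _ _ _ _ idfun psi' \o snd).
pose Phi2 : {linear (tensor M M' * tensor N N')%type -> tensor M N'} :=
  (T _ _ _ _ idfun phi' \o fst) \+ (T _ _ _ _ psi idfun \o snd).
pose Psi1 : {linear (tensor N M' * tensor M N')%type -> tensor M M'} :=
  (T _ _ _ _ psi idfun \o fst) \+ (T _ _ _ _ idfun psi' \o snd).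
pose Psi2 : {linear (tensor N M' * tensor M N')%type -> tensor N N'} :=
  (T _ _ _ _ phi idfun \o snd) \- (T _ _ _ _ idfun phi' \o fst).
exists (mk_linear (lin_pair (lin_val Phi1) (lin_val Phi2))).
exists (mk_linear (lin_pair (lin_val Psi1) (lin_val Psi2))).
split=> -[u w]; rewrite /mk_linear /=; congr (_, _).
- by rewrite linearB linearD /= El Er TC scalerDl addrACA addNr addr0.
- rewrite linearB linearD /= Fl Fr TC scalerDl opprD opprK addrACA.
  by rewrite subrr add0r.
- by rewrite linearB linearD /= Fl Er TC scalerDl opprB addrACA subrr addr0.
by rewrite linearB linearD /= El Fr TC scalerDl addrC addrA subrK.
Qed.

End IsoUpTo.

(** * Scalars killing a class of [K0] *)

Section Kills.
Variable A : comPzRingType.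
Implicit Types (f g a : A) (x y : K0 A).

Definition kills f x := exists M N : fgpModule A,
  x = K0_class M - K0_class N /\ iso_upto f M N.

Lemma kills0 x : kills 0 x.
Proof.
by have [M [N ->]] := K0_sub x; exists M, N; split=> //; exact: iso_upto0.
Qed.

Lemma kills1 x : kills 1 x -> x = 0.
Proof.
by move=> [M [N [-> /iso_upto1/K0_class_iso->]]]; rewrite subrr.
Qed.

Lemma killsMl a f x : kills f x -> kills (a * f) x.
Proof.
by move=> [M [N [-> E]]]; exists M, N; split=> //; exact: iso_uptoMl.
Qed.

Lemma killsMr a f x : kills f x -> kills (f * a) x.
Proof. by rewrite mulrC; exact: killsMl. Qed.

Lemma killsN f x : kills f x -> kills f (- x).
Proof.
by move=> [M [N [-> /iso_upto_sym E]]]; exists N, M; rewrite opprB.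
Qed.

Lemma kills_addr f x y : kills f x -> kills f y -> kills f (x + y).
Proof.
move=> [M [N [-> E]]] [M' [N' [-> E']]].
exists (prod_mod M M'), (prod_mod N N'); split; last exact: iso_upto_prod.
by rewrite !K0_class_prod; ring.
Qed.

Lemma kills_addM f g x y : kills f x -> kills g y -> kills (f + g) (x * y).
Proof.
move=> [M [N [-> E]]] [M' [N' [-> E']]].
exists (prod_mod (tensor_mod M M') (tensor_mod N N')).
exists (prod_mod (tensor_mod N M') (tensor_mod M N')).
split; last exact: iso_upto_tensor.
by rewrite !K0_class_prod !K0_class_tensor; ring.
Qed.

(** As [0] kills every class, this is the case [g = 0] of [kills_addM]. *)
Lemma kills_mulr f x y : kills f x -> kills f (x * y).
Proof. by move=> fx; rewrite -[f]addr0; apply/kills_addM/kills0. Qed.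

Lemma kills_idem_add f g x :
  x * x = x -> kills f x -> kills g x -> kills (f + g) x.
Proof. by move=> {3}<-; exact: kills_addM. Qed.

(** * Nilpotence of the scalars killing a positive integer *)

(** A zero column added to [B] and a zero row added to [C] make both square without changing the
    product, and the second determinant vanishes. *)
Lemma det_mul_thin n (B : 'M[A]_(n.+1, n)) (C : 'M[A]_(n, n.+1)) :
  \det (B *m C) = 0.
Proof.
rewrite -[B *m C]add0r -(mul0mx _ (0 : 'rV_n.+1)).
rewrite -(@mul_row_col _ n.+1 1 n n.+1 0 B 0 C) det_mulmx mulrC.
rewrite [X in X * _](expand_det_row _ 0) big1 ?mul0r // => j _.
by rewrite mxE; case: splitP => k // _; rewrite mxE mul0r.
Qed.

Lemma scale_factor_rV f n (p : {linear 'rV[A]_n.+1 -> 'rV[A]_n})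
    (q : {linear 'rV[A]_n -> 'rV[A]_n.+1}) :
  (forall v, q (p v) = f *: v) -> f ^+ n.+1 = 0.
Proof.
move=> E; rewrite -(det_scalar n.+1) -(det_mul_thin (lin1_mx p) (lin1_mx q)).
congr (\det _); apply/row_matrixP => i.
by rewrite !rowE mulmxA !mul_rV_lin1 E mul_mx_scalar.
Qed.

Lemma retract_rV (M : fgpModule A) : exists n (i : {linear M -> 'rV[A]_n})
  (s : {linear 'rV[A]_n -> M}), cancel i s.
Proof.
have [fg pr] := fgpP M; have [n [s ss]] := fin_generatedP fg.
by have [i iP] := pr _ _ s idfun ss; exists n, i, s.
Qed.

(** Reduction to free modules: [M] is a summand of ['rV[A]_n], and the factorization extends to the
    complement by the identity in one direction and multiplication by [f] in the other. *)
Lemma scale_factor_fgp f (M : fgpModule A) (p : {linear (A^o * M)%type -> M})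
    (q : {linear M -> (A^o * M)%type}) :
  (forall v, q (p v) = f *: v) -> exists n, f ^+ n = 0.
Proof.
move=> E; have [n [i [s sK]]] := retract_rV M; exists n.+1.
have [h [h' [hK h'K]]] := (iso_upto1 _ _).2 (rVS_iso A n).
pose p1 : {linear (A^o * 'rV[A]_n)%type -> (A^o * M)%type} :=
  mk_linear (lin_pair (@lin_fst _ _ _) (lin_comp (lin_val s) (@lin_snd _ _ _))).
pose q1 : {linear (A^o * M)%type -> (A^o * 'rV[A]_n)%type} :=
  mk_linear (lin_pair (@lin_fst _ _ _) (lin_comp (lin_val i) (@lin_snd _ _ _))).
(* The projection onto the kernel of [s], which is the complement of the image of [i]. *)
pose r : {linear 'rV[A]_n -> 'rV[A]_n} := idfun \- (i \o s).
pose r1 : {linear 'rV[A]_n -> (A^o * 'rV[A]_n)%type} :=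
  mk_linear (lin_pair (@lin_zero _ _ _)
    (lin_comp (@lin_scale _ f _) (lin_val r))).
pose p' : {linear 'rV[A]_n.+1 -> 'rV[A]_n} :=
  ((i \o p \o p1) \+ (r \o snd)) \o h.
pose q' : {linear 'rV[A]_n -> 'rV[A]_n.+1} :=
  h' \o ((q1 \o q \o s) \+ r1).
apply: (@scale_factor_rV f n p' q') => v.
have sr w : s (r w) = 0 by rewrite /r /= linearB /= sK subrr.
have Es : s (p' v) = p (p1 (h v)) by rewrite /p' /= linearD /= sK sr addr0.
have rr w : r (i w) = 0 by rewrite /r /= sK subrr.
have Er : r (p' v) = r (h v).2.
  rewrite [p' v]/(i (p (p1 (h v))) + r (h v).2) linearD rr add0r.
  by have -> w : r w = w - i (s w) by []; rewrite sr raddf0 subr0.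
have -> w : q' w = h' (q1 (q (s w)) + (0, f *: r w)) by [].
rewrite Es Er E.
rewrite [X in h' X](_ : _ = f *: h v) ?linearZ /= ?hK ?scale1r //.
case: (h v) => a w; congr (_, _); first exact: addr0.
by rewrite -[LHS]/(f *: i (s w) + f *: (w - i (s w))) -scalerDr addrC subrK.
Qed.

(** Up to a common summand [P], [M] is the sum of [A] and [K], where [K] is the sum of [A^n] and
    [N]. On [M], multiplication by [f] factors through [N]; so on the sum of [A], [K] and [P] it
    factors through [K * P], which lacks the summand [A]. *)
Lemma kills_natS f n : kills f n.+1%:R -> exists m, f ^+ m = 0.
Proof.
move=> [M [N [E [phi [psi [psiK _]]]]]].
have {}E : K0_class (prod_mod (unit_mod A) (prod_mod (free_mod A n) N)) =
           K0_class M.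
  rewrite !K0_class_prod K0_class_unit K0_class_free addrA nat1r E.
  by rewrite subrK.
have [P EP] := K0_class_eq E; move: EP.
set K := prod_mod (free_mod A n) N => EP.
have /iso_upto1[h [h' [hK h'K]]] := mod_iso_trans (prodA_iso _ _ _) EP.
pose fN : {linear (M * P)%type -> N} := phi \o fst.
pose fP : {linear (M * P)%type -> P} :=
  mk_linear (lin_comp (@lin_scale _ f _) (@lin_snd _ _ _)).
pose p1 : {linear (M * P)%type -> (K * P)%type} :=
  mk_linear (lin_pair (lin_pair (@lin_zero _ _ _) (lin_val fN)) (lin_val fP)).
pose qM : {linear (K * P)%type -> M} := psi \o snd \o fst.
pose q1 : {linear (K * P)%type -> (M * P)%type} :=
  mk_linear (lin_pair (lin_val qM) (@lin_snd _ _ _)).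
apply: (@scale_factor_fgp f (prod_mod K P) (p1 \o h) (h' \o q1)) => v /=.
have -> : (psi (phi (h v).1), f *: (h v).2) = f *: h v.
  by rewrite psiK [h v in RHS]surjective_pairing.
by rewrite linearZ /= hK scale1r.
Qed.

End Kills.

(** * Local ranks from an idempotent matrix *)

Section LocalRank.
Variable A : comPzRingType.

Section Minors.
Variables (n : nat) (E : 'M[A]_n) (S : {set 'I_n}).

Definition mixed_mx : 'M[A]_n :=
  \matrix_(i, j) (if i \in S then E i j else (1%:M - E) i j).

Definition select_mx : 'M[A]_(#|S|, n) := rowsub enum_val 1%:M.

Lemma select_mx_mul m (B : 'M[A]_(n, m)) :
  select_mx *m B = rowsub enum_val B.
Proof. by rewrite mul_rowsub_mx mul1mx. Qed.

Lemma select_mxK : select_mx *m select_mx^T = 1%:M.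
Proof.
rewrite select_mx_mul; apply/matrixP => i j; rewrite !mxE.
by rewrite (inj_eq enum_val_inj) eq_sym.
Qed.

Lemma select_tr_mul m (B : 'M[A]_(n, m)) :
  select_mx^T *m (select_mx *m B) =
  \matrix_(i, j) (if i \in S then B i j else 0).
Proof.
rewrite select_mx_mul; apply/matrixP => i j; rewrite !mxE.
under eq_bigr => k _ do rewrite !mxE.
rewrite -(@big_enum_val _ _ +%R _ (mem S) (fun k => (k == i)%:R * B k j)).
case: ifP => [iS|/negbT iS].
  rewrite (bigD1 i) //= eqxx mul1r big1 ?addr0 // => k /andP[_ /negbTE->].
  by rewrite mul0r.
rewrite big1 // => k kS; rewrite (_ : k == i = false) ?mul0r //.
by apply: contraNF iS => /eqP<-.
Qed.

Lemma select_mixed_mx : select_mx *m mixed_mx = select_mx *m E.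
Proof.
rewrite !select_mx_mul; apply/matrixP => i j; rewrite !mxE.
by rewrite enum_valP.
Qed.

Hypothesis EE : E *m E = E.

(** Right multiplication by [E] fixes the rows of [E] and annihilates those of [1 - E], so only the
    rows in [S] survive. *)
Lemma mixed_mx_idem :
  mixed_mx *m E = select_mx^T *m (select_mx *m mixed_mx).
Proof.
rewrite select_mixed_mx select_tr_mul; apply/matrixP => i j.
rewrite [RHS]mxE; case: ifP => iS.
  rewrite -[in RHS]EE !mxE; apply: eq_bigr => k _.
  by rewrite mxE iS.
have <- : ((1%:M - E) *m E) i j = 0 by rewrite mulmxBl mul1mx EE subrr mxE.
by rewrite [in RHS]mxE [in LHS]mxE; apply: eq_bigr => k _; rewrite mxE iS.
Qed.

End Minors.

(** For each permutation, distributing the product of the entries of [E + (1 - E)] gives one term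
    for each [S]. *)
Lemma sum_det_mixed_mx n (E : 'M[A]_n) :
  \sum_(S : {set 'I_n}) \det (mixed_mx E S) = 1.
Proof.
rewrite -(det1 A n) /determinant exchange_big /=; apply: eq_bigr => s _.
rewrite -big_distrr /=; congr (_ * _).
transitivity (\prod_i (E i (s i) + (1%:M - E) i (s i))).
  rewrite bigA_distr; apply: eq_bigr => S _; apply: eq_bigr => i _.
  by rewrite mxE.
apply: eq_bigr => i _; by rewrite !mxE addrCA subrr addr0.
Qed.

Lemma kills_det_mixed_mx (M : fgpModule A) n (i : {linear M -> 'rV[A]_n})
    (s : {linear 'rV[A]_n -> M}) (S : {set 'I_n}) :
  cancel i s ->
  kills (\det (mixed_mx (lin1_mx (i \o s)) S)) (K0_class M - #|S|%:R).
Proof.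
move=> sK; set E := lin1_mx _; set B := mixed_mx E S.
have uE u : u *m E = i (s u) by rewrite mul_rV_lin1.
have EE : E *m E = E.
  by apply/row_matrixP => j; rewrite !rowE mulmxA !uE sK.
pose U := select_mx S.
exists M, (free_mod A #|S|); split; first by rewrite K0_class_free.
(* As [B *m E = U^T *m (U *m B)], each composite brings [B] next to its adjugate, which leaves the
   scalar [\det B]. *)
pose phi : {linear M -> 'rV[A]_#|S|} := mulmxr (\adj B *m U^T) \o i.
pose psi : {linear 'rV[A]_#|S| -> M} := s \o mulmxr (U *m B).
exists phi, psi; split=> [x|c]; rewrite /phi /psi /=.
  rewrite -!mulmxA -mixed_mx_idem // (mulmxA (\adj B)) mul_adj_mx.
  rewrite mul_scalar_mx -scalemxAr uE.
  by rewrite linearZ /= !sK.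
rewrite -uE -!mulmxA (mulmxA B E) mixed_mx_idem // -!mulmxA.
rewrite (mulmxA B (\adj B)) mul_mx_adj mul_scalar_mx -!scalemxAr.
by rewrite select_mxK mulmx1 select_mxK mulmx1.
Qed.

(** The partitions of unity for [M] and [N] are multiplied together, so that each term controls both
    ranks. *)
Lemma kills_local_rank (x : K0 A) :
  exists (I : finType) (d : I -> A) (k : I -> int),
    \sum_i d i = 1 /\ forall i, kills (d i) (x - (k i)%:~R).
Proof.
have [M [N ->]] := K0_sub x.
have [m [i [s sK]]] := retract_rV M; have [n [j [t tK]]] := retract_rV N.
pose d1 (S : {set 'I_m}) := \det (mixed_mx (lin1_mx (i \o s)) S).
pose d2 (T : {set 'I_n}) := \det (mixed_mx (lin1_mx (j \o t)) T).
exists ({set 'I_m} * {set 'I_n})%type, (fun p => d1 p.1 * d2 p.2).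
exists (fun p : {set 'I_m} * {set 'I_n} => #|p.1|%:Z - #|p.2|%:Z : int).
split.
  rewrite -(pair_bigA _ (fun S T => d1 S * d2 T)) /= -big_distrlr /=.
  by rewrite !sum_det_mixed_mx mulr1.
move=> [S T] /=; rewrite rmorphB /= -!pmulrn opprB addrCA addrA.
rewrite [X in kills _ X](_ : _ = (K0_class M - #|S|%:R) -
  (K0_class N - #|T|%:R)); last by ring.
apply: kills_addr; first exact/killsMr/kills_det_mixed_mx.
exact/killsMl/killsN/kills_det_mixed_mx.
Qed.

End LocalRank.

(** * The correspondence between idempotents of [A] and of [K0 A] *)

Section Idempotents.
Variable A : comPzRingType.
Implicit Types (a b e f : A) (x y u v : K0 A).

Lemma kills_nilpotent f n :
  (0 < n)%N -> kills f (n%:R : K0 A) -> exists m, f ^+ m = 0.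
Proof. by case: n => // n _; exact: kills_natS. Qed.

Lemma kills_both_nilpotent f x :
  kills f x -> kills f (1 - x) -> exists m, f ^+ m = 0.
Proof.
move=> fx fx'; apply: (@kills_nilpotent f 1) => //.
by rewrite mulr1n -[1](subrK x) addrC; exact: kills_addr.
Qed.

Lemma kills_idem_sum (I : finType) (P : pred I) (d : I -> A) x : x * x = x ->
  (forall i, P i -> kills (d i) x) -> kills (\sum_(i | P i) d i) x.
Proof.
move=> xx dx; elim/big_rec: _ => [|i f Pi fx]; first exact: kills0.
by apply: kills_idem_add => //; exact: dx.
Qed.

Lemma kills_trichotomy f x (k : int) : x * x = x -> kills f (x - k%:~R) ->
  [\/ k = 0 /\ kills f x, k = 1 /\ kills f (1 - x)
    | [/\ k != 0, k != 1 & exists2 n, (0 < n)%N & kills f (n%:R : K0 A)]].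
Proof.
move=> xx fx; have [k0|k0] := eqVneq k 0.
  by constructor 1; split=> //; rewrite k0 subr0 in fx.
have [k1|k1] := eqVneq k 1.
  by constructor 2; split=> //; rewrite k1 in fx; rewrite -opprB; exact: killsN.
(* Since [x * x = x], the product of [x - k] and [x - (1 - k)] is [k * (1 - k)], whose opposite is a
   positive integer here. *)
constructor 3; split=> //; exists (absz (k * (k - 1))).
  by rewrite absz_gt0 mulf_neq0 // subr_eq0.
rewrite pmulrn gez0_abs; last by nia.
have /killsN := kills_mulr (x - (1 - k)%:~R) fx.
congr (kills f _); rewrite rmorphM !rmorphB /=.
set c : K0 A := k%:~R.
transitivity (c * (c - 1) + x - x * x); first by ring.
by rewrite xx addrK.
Qed.

(* On D(e) the class [u] is 1, and on D(1 - e) it is 0. *)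
Definition classifies e u := kills (1 - e) u /\ kills e (1 - u).

Lemma classifies_compl e u : classifies e u -> classifies (1 - e) (1 - u).
Proof. by move=> [eu eu']; split; rewrite ?subKr. Qed.

Lemma classifies_idem e u : classifies e u -> u * u = u.
Proof.
move=> [eu eu']; have := kills_addM eu eu'; rewrite subrK => /kills1.
by rewrite mulrBr mulr1 => /subr0_eq.
Qed.

(** The sum [(1 - e) + e = 1] kills both [u * (1 - v)] and [v * (1 - u)], whence [u = u * v = v]. *)
Lemma classifies_unique e u v : classifies e u -> classifies e v -> u = v.
Proof.
move=> [eu eu'] [ev ev'].
have /kills1 : kills 1 (u * (1 - v)) by rewrite -(subrK e 1); exact: kills_addM.
have /kills1 : kills 1 (v * (1 - u)) by rewrite -(subrK e 1); exact: kills_addM.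
rewrite !mulrBr !mulr1 (mulrC v) => /subr0_eq vE /subr0_eq uE.
by rewrite uE -vE.
Qed.

Lemma classifiesM e f u v :
  classifies e u -> classifies f v -> classifies (e * f) (u * v).
Proof.
move=> Eu Fv; have uu := classifies_idem Eu; have vv := classifies_idem Fv.
case: Eu Fv => eu eu' [fv fv']; split.
  rewrite [1 - _](_ : _ = (1 - e) + e * (1 - f)); last by ring.
  apply: kills_idem_add; first by rewrite mulrACA uu vv.
    exact: kills_mulr.
  by apply: killsMl; rewrite mulrC; exact: kills_mulr.
rewrite [1 - _](_ : _ = (1 - u) + (1 - v) * u); last by ring.
apply: kills_addr; first exact: killsMr.
exact/killsMl/kills_mulr.
Qed.

(** The idempotent [e * (1 - f)] kills both [u] and [1 - u], so it is nilpotent and therefore zero;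
    likewise with [e] and [f] exchanged. *)
Lemma classifies_inj e f u : e * e = e -> f * f = f ->
  classifies e u -> classifies f u -> e = f.
Proof.
have half e' f' : e' * e' = e' -> f' * f' = f' ->
    classifies e' u -> classifies f' u -> e' = e' * f'.
  move=> ee ff [_ eu] [fu _].
  have [m /idem_nilpotent E] :=
    kills_both_nilpotent (killsMl e' fu) (killsMr (1 - f') eu).
  apply/subr0_eq; rewrite -{1}[e']mulr1 -mulrBr; apply: E.
  by rewrite mulrACA ee idem_compl.
move=> ee ff Eu Fu.
by rewrite (half _ _ ee ff Eu Fu) mulrC -(half _ _ ff ee Fu Eu).
Qed.

Lemma classifies_idem_surj x : x * x = x ->
  exists e, e * e = e /\ classifies e x.
Proof.
move=> xx; have xx' := idem_compl xx.
have [I [d [k [d1 dk]]]] := kills_local_rank x.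
have tri i := kills_trichotomy xx (dk i).
(* The terms are grouped by local rank: [0], [1], or anything else. *)
pose a := \sum_(i | k i == 0) d i.
pose b := \sum_(i | k i == 1) d i.
pose c := \sum_(i | (k i != 0) && (k i != 1)) d i.
have abc : a + b = 1 - c.
  apply/eqP; rewrite eq_sym subr_eq eq_sym -d1 (bigID (fun i => k i == 0)) /=.
  rewrite -addrA; apply/eqP; congr (_ + _).
  rewrite [RHS](bigID (fun i => k i == 1)) /=; congr (_ + _).
  by apply: eq_bigl => i; have [->|_] := eqVneq (k i) 1; rewrite ?andbF.
have ax : kills a x.
  apply: kills_idem_sum => // i /eqP ki.
  by case: (tri i) => [[]|[ki' _]|[]] //; [rewrite ki in ki'|rewrite ki].
have bx : kills b (1 - x).
  apply: kills_idem_sum => // i /eqP ki.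
  by case: (tri i) => [[ki' _]|[]|[]] //; [rewrite ki in ki'|rewrite ki].
(* If two elements kill [m] and [n], their sum kills [m * n]; the empty sum kills [1]. So [c] will
   be nilpotent and [a + b = 1 - c] invertible. *)
have [n n0 cn] : exists2 n, (0 < n)%N & kills c (n%:R : K0 A).
  rewrite /c; elim/big_rec: _ => [|i f /andP[k0 k1] [n n0 fn]].
    by exists 1%N => //; exact: kills0.
  case: (tri i) => [[ki _]|[ki _]|[_ _ [m m0 dm]]].
  - by rewrite ki in k0.
  - by rewrite ki in k1.
  exists (m * n)%N; first by rewrite muln_gt0 m0.
  by rewrite natrM; exact: kills_addM.
have [m cm] := kills_nilpotent n0 cn; have [w cw] := nilpotent_unit cm.
have [l abl] := kills_both_nilpotent (killsMl b ax) (killsMr a bx).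
(* The two terms become [1 - e] and [e]; their product vanishes with [(b * a) ^+ l]. The exponent is
   [l.+1] so that each keeps a factor [a] or [b] even for [l = 0]. *)
have [s [t E]] : exists s t, (a * w) ^+ l.+1 * s + (b * w) ^+ l.+1 * t = 1.
  by apply: comax_powers; rewrite -mulrDl abc.
pose e := (b * w) ^+ l.+1 * t; exists e.
have Ee : 1 - e = (a * w) ^+ l.+1 * s by rewrite -E addrK.
split.
  apply/esym/subr0_eq; rewrite -{1}[e]mulr1 -mulrBr Ee /e mulrACA -exprMn.
  by rewrite mulrACA exprMn exprS abl mulr0 !mul0r.
split; first by rewrite Ee exprS -!mulrA; exact: killsMr.
by rewrite /e exprS -!mulrA; exact: killsMr.
Qed.

(** Multiplication by [1 - e] is zero on [A e], so zero maps to and from the zero module suffice;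
    for [e], the projection [A -> A e] and the inclusion compose both ways to multiplication by
    [e]. *)
Lemma idem_module_classifies (e : idem A) :
  classifies (val e) (K0_class (idem_module e)).
Proof.
have ee := idemE e.
have eP b : in_principal (val e) (b * val e) by apply/asboolP; exists b.
have pE (x : principal (val e)) : val x * val e = val x.
  by have /asboolP[b ->] := valP x; rewrite -mulrA ee.
split.
  exists (idem_module e), (zero_mod A); split.
    by rewrite K0_class_zero subr0.
  exists \0, \0; split=> x /=; last by apply/rowP => -[].
  apply: val_inj; rewrite linearZ /=.
  by rewrite -[RHS]/((1 - val e) * val x) mulrC mulrBr mulr1 pE subrr.
exists (unit_mod A), (idem_module e); split; first by rewrite K0_class_unit.
have fl : linear (fun a : A^o => Principal (eP a) : principal (val e)).
  by move=> a b c; apply: val_inj; rewrite linearP /= mulrDl -mulrA.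
exists (mk_linear fl), val; split=> [x|x] /=; first by rewrite mulrC.
by apply: val_inj; rewrite linearZ /= pE; rewrite /GRing.scale /= mulrC pE.
Qed.

Lemma classifies_add (e f : idem A) (u v : idem (K0 A)) :
  classifies (val e) (val u) -> classifies (val f) (val v) ->
  classifies (val (e + f)) (val (u + v)).
Proof.
move=> Eu Fv; rewrite !idem_addE_compl; apply/classifies_compl/classifiesM.
  exact/classifies_compl/classifiesM/classifies_compl.
exact/classifies_compl/classifiesM/classifies_compl.
Qed.

End Idempotents.

Theorem theorem4p10 (A : comPzRingType) :
  exists f : {additive idem A -> idem (K0 A)},
    bijective f /\ forall e : idem A, val (f e) = K0_class (idem_module e).
Proof.
pose F (e : idem A) : idem (K0 A) :=
  Idem (introT eqP (esym (classifies_idem (idem_module_classifies e)))).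
have FE e : classifies (val e) (val (F e)) := idem_module_classifies e.
(* Both sides are classified by [e + f], hence equal. *)
have FD : {morph F : e f / e + f}.
  move=> e f; apply: val_inj.
  exact: classifies_unique (FE (e + f)) (classifies_add (FE e) (FE f)).
have F0 : F 0 = 0 by apply: (addrI (F 0)); rewrite -FD !addr0.
have Fsurj (x : idem (K0 A)) : exists e, F e = x.
  have [e [ee Ex]] := classifies_idem_surj (idemE x).
  pose e' := Idem (introT eqP (esym ee)); exists e'; apply: val_inj.
  exact: (classifies_unique (FE e') Ex).
pose G x := projT1 (cid (Fsurj x)).
have GK x : F (G x) = x by rewrite /G; case: cid.
pose f : {additive idem A -> idem (K0 A)} :=
  HB.pack F (GRing.isNmodMorphism.Build _ _ F (F0, FD)).
exists f; split=> //.
exists G => // e; apply: val_inj.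
apply: (classifies_inj (idemE _) (idemE _) (FE (G (F e)))).
by rewrite GK; exact: FE.
Qed.
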